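(* Let $w_1,w_2,n$ be positive integers with $n\ge 2$, $w_1\ge 2$ and $w_1\ge w_2$. Let $C$ be an $[n,k]_q$-linear code (a $k$-dimensional $\mathbb{F}_q$-linear subspace of $\mathbb{F}_q^n$) containing $\mathbf{1}=(1,1,\dots,1)$. Suppose there exists a codeword $c=(c_1,c_2,\dots,c_n)\in C$ such that $|\mathrm{Im}\,c|\ge 2$ and $\mathrm{Im}\,c$ is $(w_1,w_2)$-separable additively or multiplicatively. Then $C$ is not a $(w_1,w_2)$-separating code.
   Context: $\mathbb{F}_q$ is the finite field with $q$ elements. For a word $x=(x_1,\dots,x_n)\in\mathbb{F}_q^n$, $\mathrm{Im}\,x=\{x_i\mid 1\le i\le n\}$. For $E,F\subset\mathbb{F}_q$, $E+F=\{a+b\mid a\in E,b\in F\}$ and $EF=\{ab\mid a\in E,b\in F\}$. A subset $U\subset\mathbb{F}_q$ is additively (resp. multiplicatively) $(w_1,w_2)$-separable if there exist subsets $E,F\subset U$ with $1\le|E|\le w_1$ and $1\le|F|\le w_2$ such that $U\subset E+F$ (resp. $U\subset EF$). For a nonempty subset $U$ of a code $C\subset\mathbb{F}_q^n$, its descendant set is $\mathrm{desc}\,U=\{x\in\mathbb{F}_q^n\mid \forall i\ \exists y\in U:\ x_i=y_i\}$. The code $C$ is $(w_1,w_2)$-separating if, whenever $U_1,U_2$ are disjoint subsets of $C$ with $1\le|U_1|\le w_1$ and $1\le|U_2|\le w_2$, the sets $\mathrm{desc}\,U_1$ and $\mathrm{desc}\,U_2$ are disjoint. *)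

(* Defs.v *)
From HB Require Import structures.
From mathcomp Require Import all_boot all_order all_algebra.

Set Implicit Arguments.
Unset Strict Implicit.
Unset Printing Implicit Defensive.

Import GRing.Theory.
Local Open Scope ring_scope.

Definition word_image (F : finFieldType) (n : nat) (x : 'rV[F]_n) : {set F} :=
  [set x 0 i | i : 'I_n].

Definition sumset (F : finFieldType) (A B : {set F}) : {set F} :=
  [set a + b | a in A, b in B].

Definition productset (F : finFieldType) (A B : {set F}) : {set F} :=
  [set a * b | a in A, b in B].

Definition additively_separable (F : finFieldType) (w1 w2 : nat)
    (U : {set F}) : Prop :=
  exists A B : {set F},
    [/\ A \subset U /\ B \subset U,
        (1 <= #|A| <= w1)%N,
        (1 <= #|B| <= w2)%N
      & U \subset sumset A B].

Definition multiplicatively_separable (F : finFieldType) (w1 w2 : nat)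
    (U : {set F}) : Prop :=
  exists A B : {set F},
    [/\ A \subset U /\ B \subset U,
        (1 <= #|A| <= w1)%N,
        (1 <= #|B| <= w2)%N
      & U \subset productset A B].

(* Only meaningful for nonempty U; [separating] applies it to such U only. *)
Definition desc (F : finFieldType) (n : nat) (U : {set 'rV[F]_n}) :
    {set 'rV[F]_n} :=
  [set x : 'rV[F]_n | [forall i : 'I_n, [exists y in U, x 0 i == y 0 i]]].

Definition separating (F : finFieldType) (n w1 w2 : nat)
    (C : {set 'rV[F]_n}) : Prop :=
  forall U1 U2 : {set 'rV[F]_n},
    U1 \subset C -> U2 \subset C -> [disjoint U1 & U2] ->
    (1 <= #|U1| <= w1)%N -> (1 <= #|U2| <= w2)%N ->
    [disjoint desc U1 & desc U2].

(* Main.v *)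
(** If every coordinate of c is a sum a + b with a in E and b in F, choosing one
    such pair at each i gives the word x_i = a_i = c_i - b_i, which is a
    descendant both of the constant words a.1 (a in E) and of the words c - b.1
    (b in F).  The first are constant and the second are not, since c is not
    constant, so the two sets are disjoint.  In the multiplicative case
    c - b.1 is replaced by b^-1 c, which requires care with b = 0: if 0 is in E
    then 0 may be dropped from F, and otherwise E and F exchange roles. *)
Require Import Defs.
From HB Require Import structures.
From mathcomp Require Import all_boot all_order all_algebra.

Set Implicit Arguments.
Unset Strict Implicit.
Unset Printing Implicit Defensive.

Import GRing.Theory.
Local Open Scope ring_scope.

(** Needed when the two factor sets exchange roles in the multiplicative case, since their size
    bounds are exchanged with them. *)
Lemma separating_sym (F : finFieldType) (n w1 w2 : nat) (C : {set 'rV[F]_n}) :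
  separating w1 w2 C -> separating w2 w1 C.
Proof.
move=> sep U1 U2 U1C U2C; rewrite disjoint_sym => dis cardU1 cardU2.
by rewrite disjoint_sym; apply: sep.
Qed.

Lemma word_image_nonconst (F : finFieldType) (n : nat) (c : 'rV[F]_n) (d : F) :
  (2 <= #|word_image c|)%N -> c != const_mx d.
Proof.
apply: contraL => /eqP ->; rewrite -leqNgt.
apply: leq_trans (_ : #|[set d]| <= 1)%N; last by rewrite cards1.
by apply/subset_leq_card/subsetP => _ /imsetP[i _ ->]; rewrite mxE set11.
Qed.

Section LinearCode.

Variables (F : finFieldType) (n : nat) (C : {vspace 'rV[F]_n}).
Hypothesis C1 : (const_mx 1 : 'rV[F]_n) \in C.

Lemma const_mx_in_code (a : F) : (const_mx a : 'rV[F]_n) \in C.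
Proof.
suff -> : const_mx a = a *: (const_mx 1 : 'rV[F]_n) by apply: rpredZ.
by apply/rowP => i; rewrite !mxE mulr1.
Qed.

(** Common core of both cases: [g b] will be c - b.1 or b^-1 c. Each coordinate of some word [g b]
    lies in [A], so a single word can be assembled that descends from the constants and from the
    [g b] alike. *)
Lemma not_separating_const (w1 w2 : nat) (A B : {set F}) (g : F -> 'rV[F]_n) :
    (0 < n)%N -> (#|A| <= w1)%N -> (#|B| <= w2)%N ->
    {in B, forall b, g b \in C} ->
    {in B, forall b a, g b != const_mx a} ->
    (forall i, exists a b, [/\ a \in A, b \in B & a = g b 0 i]) ->
  ~ separating w1 w2 [set x : 'rV[F]_n | x \in C].
Proof.
move=> n_gt0 cardA cardB gC gN cover sep.
(* Covering one coordinate shows that [A] and [B] are nonempty, hence so are [U1] and [U2] below. *)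
have [a0 [b0 [a0A b0B _]]] := cover (Ordinal n_gt0).
pose x : 'rV[F]_n :=
  (* The default 0 is never taken: [cover] makes every pick succeed. *)
  \row_i odflt 0 [pick a in A | [exists b in B, a == g b 0 i]].
have xP i : exists2 a, a \in A & exists2 b, b \in B & x 0 i = a /\ a = g b 0 i.
  rewrite mxE; case: pickP => [a /andP[aA /exists_inP[b bB /eqP ab]] | none].
    by exists a => //; exists b.
  have [a [b [aA bB ab]]] := cover i.
  by have /negP[] := none a; rewrite aA; apply/exists_inP; exists b => //; apply/eqP.
pose U1 : {set 'rV[F]_n} := [set const_mx a | a in A].
pose U2 := [set g b | b in B].
have U1C : U1 \subset [set y | y \in C].
  by apply/subsetP => _ /imsetP[a _ ->]; rewrite inE const_mx_in_code.
have U2C : U2 \subset [set y | y \in C].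
  by apply/subsetP => _ /imsetP[b bB ->]; rewrite inE gC.
have U12 : [disjoint U1 & U2].
  rewrite disjoints_subset; apply/subsetP => _ /imsetP[a _ ->]; rewrite inE.
  by apply/imsetP => -[b bB /esym/eqP]; apply/negP/gN.
have cardU1 : (1 <= #|U1| <= w1)%N.
  rewrite (leq_trans (leq_imset_card _ _) cardA) andbT card_gt0.
  by apply/set0Pn; exists (const_mx a0); apply: imset_f.
have cardU2 : (1 <= #|U2| <= w2)%N.
  rewrite (leq_trans (leq_imset_card _ _) cardB) andbT card_gt0.
  by apply/set0Pn; exists (g b0); apply: imset_f.
have xU1 : x \in desc U1.
  rewrite inE; apply/forallP => i; have [a aA [b _ [xa _]]] := xP i.
  by apply/exists_inP; exists (const_mx a); rewrite ?imset_f // xa mxE.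
have xU2 : x \in desc U2.
  rewrite inE; apply/forallP => i; have [a _ [b bB [xa ab]]] := xP i.
  by apply/exists_inP; exists (g b); rewrite ?imset_f // xa ab.
by have := disjointFr (sep U1 U2 U1C U2C U12 cardU1 cardU2) xU1; rewrite xU2.
Qed.

Variable c : 'rV[F]_n.
Hypotheses (n_gt0 : (0 < n)%N) (cC : c \in C).
Hypothesis cN : forall d, c != const_mx d.

Lemma not_separating_add (w1 w2 : nat) (A B : {set F}) :
    (#|A| <= w1)%N -> (#|B| <= w2)%N -> (forall i, c 0 i \in sumset A B) ->
  ~ separating w1 w2 [set x : 'rV[F]_n | x \in C].
Proof.
move=> cardA cardB cAB.
apply: (@not_separating_const _ _ A B (fun b => c - const_mx b)) => //.
- by move=> b _; rewrite rpredB ?const_mx_in_code.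
- move=> b _ a; rewrite subr_eq; apply: contra (cN (a + b)) => /eqP ->.
  by apply/eqP/rowP => i; rewrite !mxE.
- move=> i; have /imset2P[a b aA bB cE] := cAB i.
  by exists a, b; rewrite !mxE cE addrK.
Qed.

(** Every b in [B] is invertible, so c_i = ab reads a = b^-1 c_i, and a constant b^-1 c would force
    c to be constant. *)
Lemma not_separating_mul (w1 w2 : nat) (A B : {set F}) :
    (#|A| <= w1)%N -> (#|B| <= w2)%N -> 0 \notin B ->
    (forall i, c 0 i \in productset A B) ->
  ~ separating w1 w2 [set x : 'rV[F]_n | x \in C].
Proof.
move=> cardA cardB B0 cAB.
have Bn0 b : b \in B -> b != 0 by apply: contraTneq => ->.
apply: (@not_separating_const _ _ A B (fun b => b^-1 *: c)) => //.
- by move=> b _; rewrite rpredZ.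
- move=> b bB a; apply: contra (cN (b * a)) => /eqP/rowP ca.
  by apply/eqP/rowP => i; have := ca i; rewrite !mxE => <-; rewrite mulVKf ?Bn0.
- move=> i; have /imset2P[a b aA bB cE] := cAB i.
  by exists a, b; rewrite mxE cE mulrC mulfK ?Bn0.
Qed.

End LinearCode.

Lemma productset_sym (F : finFieldType) (A B : {set F}) :
  productset A B = productset B A.
Proof.
by apply/setP => x; apply/imset2P/imset2P => -[a b ? ? ->]; exists b a;
  rewrite // mulrC.
Qed.

(** The factor 0 of [B] only produces the product 0, which is also 0 * b with 0 from [A] and b the
    nonzero factor of [u] in [B]. *)
Lemma productset_drop0 (F : finFieldType) (A B : {set F}) (u x : F) :
    0 \in A -> u != 0 -> u \in productset A B -> x \in productset A B ->
  x \in productset A (B :\ 0).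
Proof.
move=> A0 u0 /imset2P[a b aA bB uE] /imset2P[a' b' a'A b'B ->].
have b0 : b != 0 by apply: contraNneq u0 => b0; rewrite uE b0 mulr0.
have [-> | b'0] := eqVneq b' 0.
  by apply/imset2P; exists 0 b; rewrite ?inE ?b0 // mulr0 mul0r.
by apply/imset2P; exists a' b'; rewrite ?inE ?b'0.
Qed.

Theorem theorem2p1 (q : nat) (F : finFieldType) (hq : #|F| = q)
    (w1 w2 n k : nat)
    (hw2 : (0 < w2)%N) (hn : (2 <= n)%N) (hw1 : (2 <= w1)%N)
    (hw : (w2 <= w1)%N)
    (C : {vspace 'rV[F]_n}) (hk : \dim C = k)
    (h1 : (const_mx 1 : 'rV[F]_n) \in C)
    (hc : exists c : 'rV[F]_n,
        [/\ c \in C,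
            (2 <= #|word_image c|)%N
          & additively_separable w1 w2 (word_image c) \/
            multiplicatively_separable w1 w2 (word_image c)]) :
  ~ separating w1 w2 [set x : 'rV[F]_n | x \in C].
Proof.
have n_gt0 : (0 < n)%N by apply: ltnW.
case: hc => c [cC cIm csep].
have cN d := word_image_nonconst d cIm.
have imc i : c 0 i \in word_image c by apply: imset_f.
case: csep => -[A [B [_ /andP[_ cardA] /andP[_ cardB] /subsetP AB]]].
  by apply: (not_separating_add h1 n_gt0 cC cN cardA cardB) => i; apply: AB.
have cAB i : c 0 i \in productset A B by apply: AB.
have [A0 | A0] := boolP (0 \in A); last first.
  (* Here 0 is not in [A], so the elements of [A] are inverted and the constants come from [B]. *)
  move/separating_sym; apply: (not_separating_mul h1 n_gt0 cC cN cardB cardA A0).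
  by move=> i; rewrite productset_sym.
(* The zero word is constant, so c has a nonzero coordinate; it serves as [u] in
   [productset_drop0]. *)
have /rV0Pn[j cj] : c != 0 by apply: cN.
apply: (@not_separating_mul _ _ _ h1 c n_gt0 cC cN _ _ A (B :\ 0)) => //.
- by apply: leq_trans cardB; apply/subset_leq_card/subD1set.
- by rewrite !inE eqxx.
- by move=> i; apply: productset_drop0 A0 cj (cAB j) (cAB i).
Qed.
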